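(* Let $E=(E^0,E^1,r,s)$ be a finite directed graph with at least one cycle. Let $A$ denote the vertex matrix of $E$, with spectral radius $\rho(A)$, and let $\sigma$ denote the shift on the infinite-path space $E^\infty$. Then $$\frac1N\ln\Big(\max_{z\in E^\infty}|\sigma^{-N}(z)|\Big)\to\ln\rho(A)\quad\text{as } N\to\infty.$$
   Context: $E^\infty$ is the set of infinite paths $z=z_1z_2\cdots$ with $z_i\in E^1$ and $s(z_i)=r(z_{i+1})$ for all $i$. The shift is $\sigma(z)=z_2z_3\cdots$, and $|\sigma^{-N}(z)|$ is the number of $w\in E^\infty$ with $\sigma^N(w)=z$. The vertex matrix $A$ is the $E^0\times E^0$ matrix with entries $A(v,w)=|\{e\in E^1:r(e)=v,\ s(e)=w\}|$. *)

(* Defs.v *)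
From HB Require Import structures.
From mathcomp Require Import all_boot all_order all_algebra.
From mathcomp Require Import finmap.
From mathcomp Require Import all_classical all_reals all_analysis.
From mathcomp Require Import complex.

Set Implicit Arguments.
Unset Strict Implicit.
Unset Printing Implicit Defensive.

Import Order.TTheory GRing.Theory Num.Theory.

Local Open Scope classical_set_scope.
Local Open Scope ring_scope.

Record digraph := Digraph {
  vertex : finType;
  edge : finType;
  rng : edge -> vertex;
  src : edge -> vertex
}.

Section Paths.
Variable E : digraph.

Definition composable : rel (edge E) := fun e f => src e == rng f.

(* A cycle is a nonempty closed path.  It may repeat vertices; asking for a
   simple one would not change whether a cycle exists. *)
Definition has_cycle : Prop :=
  exists c : seq (edge E), c != [::] /\ path.cycle composable c.

Definition infinite_path : set (nat -> edge E) :=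
  [set z | forall i, src (z i) = rng (z i.+1)].

Definition shift (z : nat -> edge E) : nat -> edge E := fun i => z i.+1.

Definition shift_preimage (N : nat) (z : nat -> edge E) : set (nat -> edge E) :=
  infinite_path `&` (iter N shift) @^-1` [set z].

(* fset_set is meaningful only on finite sets; see finite_shift_preimage. *)
Definition card_shift_preimage (N : nat) (z : nat -> edge E) : nat :=
  #|` fset_set (shift_preimage N z)|.

Lemma iter_shift N z i : iter N shift z i = z (N + i)%N.
Proof. by elim: N i => // N IH i; rewrite iterS /shift IH addnS. Qed.

Lemma shift_preimage_card_le N z :
  (shift_preimage N z #<= `I_(#|edge E| ^ N))%card.
Proof.
pose f (w : nat -> edge E) : {ffun 'I_N -> edge E} := [ffun i : 'I_N => w i].
have f_inj : {in shift_preimage N z &, injective f}.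
  move=> v w; rewrite !inE => -[_ /= vz] [_ /= wz] fvw.
  apply/funext => i; have [ltiN|leNi] := ltnP i N.
    by move/ffunP/(_ (Ordinal ltiN)): fvw; rewrite !ffunE.
  by rewrite -(subnKC leNi) -!iter_shift vz wz.
rewrite -(card_le_eql (inj_card_eq f_inj)).
pose g (u : {ffun 'I_N -> edge E}) : nat := enum_rank u.
have g_inj : {in f @` shift_preimage N z &, injective g}.
  by move=> u v _ _ /ord_inj/enum_rank_inj.
rewrite -(card_le_eql (inj_card_eq g_inj)).
apply: subset_card_le => _ [u _ <-] /=.
by have := ltn_ord (enum_rank u); rewrite [ltnRHS]card_ffun card_ord.
Qed.

Lemma finite_shift_preimage N z : finite_set (shift_preimage N z).
Proof.
by apply/finite_set_leP; exists (#|edge E| ^ N)%N; exact: shift_preimage_card_le.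
Qed.

Lemma card_shift_preimage_le N z :
  (card_shift_preimage N z <= #|edge E| ^ N)%N.
Proof. exact/geq_card_fset_set/shift_preimage_card_le. Qed.

(* The counts are naturals bounded by card_shift_preimage_le, so this supremum
   is a maximum as soon as there is an infinite path; see
   max_shift_preimage_attained. *)
Definition max_shift_preimage (R : realType) (N : nat) : R :=
  sup [set (card_shift_preimage N z)%:R | z in infinite_path].

Lemma max_shift_preimage_attained (R : realType) N :
  infinite_path !=set0 ->
  exists2 z, infinite_path z &
    max_shift_preimage R N = (card_shift_preimage N z)%:R /\
    (forall w, infinite_path w ->
      (card_shift_preimage N w <= card_shift_preimage N z)%N).
Proof.
move=> [z0 Ez0].
pose P n := `[< exists2 z, infinite_path z & card_shift_preimage N z = n >].
have exP : exists n, P n.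
  by exists (card_shift_preimage N z0); apply/asboolP; exists z0.
have ubP n : P n -> (n <= #|edge E| ^ N)%N.
  by move=> /asboolP[z _ <-]; exact: card_shift_preimage_le.
have [m /asboolP[z Ez zm] mmax] := ex_maxnP exP ubP.
have zmax w : infinite_path w ->
    (card_shift_preimage N w <= card_shift_preimage N z)%N.
  by move=> Ew; rewrite zm; apply: mmax; apply/asboolP; exists w.
have ub : ubound [set (card_shift_preimage N w)%:R | w in infinite_path]
    ((card_shift_preimage N z)%:R : R).
  by move=> _ [w Ew <-]; rewrite ler_nat zmax.
exists z => //; split=> //; apply/eqP; rewrite eq_le; apply/andP; split.
  by apply: ge_sup => //; exists (card_shift_preimage N z)%:R; exists z.
apply: ub_le_sup; last by exists z.
by exists (card_shift_preimage N z)%:R.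
Qed.

(* Rows and columns are indexed by the vertices through enum_val. *)
Definition vertex_matrix (K : nzRingType) : 'M[K]_#|vertex E| :=
  \matrix_(i, j)
    #|[set e : edge E | (rng e == enum_val i) && (src e == enum_val j)]|%:R.

End Paths.

(* The supremum is over the finite spectrum of A, hence a maximum when n > 0.
   The norm of R[i] takes its (real) values in R[i], hence the Re. *)
Definition spectral_radius (R : realType) (n : nat) (A : 'M[R[i]]_n) : R :=
  sup [set complex.Re `|l| | l in [set l : R[i] | eigenvalue A l]].

(* Main.v *)
(* A preimage of z under the N-th power of the shift is a path of length N ending
   at the range of z, so the counts are column sums of A^N.  Upper bound: by
   Cayley-Hamilton the product of the factors A - l over the eigenvalues l
   annihilates A; peeling off the factors one at a time, each first-order
   recursion a(N+1) = l a(N) + O(r^N) with |l| < r forces a(N) = O(r^N).  Lower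
   bound: a left eigenvector v for l <> 0 gives |l|^N |v_x| = O(c_N(x)), where
   c_N(x) is the column sum at x, and its support contains the range of some
   infinite path, because every vertex of the support has an edge leading out of
   it to another vertex of the support. *)
Require Import Defs.
From mathcomp Require Import all_boot all_order all_algebra.
From mathcomp Require Import finmap all_classical all_reals all_analysis.
From mathcomp Require Import complex ring lra.
Import Order.TTheory GRing.Theory Num.Theory.
Import numFieldNormedType.Exports.
Local Open Scope classical_set_scope.
Local Open Scope ring_scope.

(** * Shift preimages counted by finite paths *)

Section PathCounts.
Set Implicit Arguments.
Unset Strict Implicit.
Variable E : digraph.
Implicit Types (e : edge E) (x : vertex E) (z : nat -> edge E) (N : nat).

(** Counts paths of length [N] with source [x], choosing the edge next to [x] first, as in
    multiplying a row vector by the vertex matrix. *)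
Fixpoint path_count N x : nat :=
  if N is N'.+1 then (\sum_(e | src e == x) path_count N' (rng e))%N else 1%N.

Definition prepend e z : nat -> edge E := fun i => if i is j.+1 then z j else e.

Lemma infinite_path_prepend e z :
  infinite_path z -> src e = rng (z 0%N) -> infinite_path (prepend e z).
Proof. by move=> Ez ez [|i] //=; exact: Ez. Qed.

(** Sorts the preimages of [z] under [N.+1] shifts by their edge at index [N], the last one before
    [z] starts. *)
Lemma shift_preimage_prepend N e z : src e = rng (z 0%N) ->
  shift_preimage N (prepend e z) =
  shift_preimage N.+1 z `&` [set w | w N = e].
Proof.
move=> ez; apply/seteqP; split=> w.
  move=> [Ew /= wz]; split; last by rewrite /= -[N in w N]addn0 -iter_shift wz.
  by split=> //=; rewrite wz.
move=> [[Ew /= wz] wN]; split=> //=; apply/funext => -[|i] /=.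
  by rewrite iter_shift addn0.
by rewrite -wz.
Qed.

Lemma card_shift_preimageE N z :
  infinite_path z -> card_shift_preimage N z = path_count N (rng (z 0%N)).
Proof.
elim: N z => [|N IH] z Ez.
  rewrite /card_shift_preimage.
  have -> : shift_preimage 0 z = [set z].
    by apply/seteqP; split=> w; [case | move=> ->].
  by rewrite fset_set1 cardfs1.
rewrite /card_shift_preimage card_fset_sum1.
rewrite (partition_big (fun w : nat -> edge E => w N) predT) //=.
rewrite [RHS]big_mkcond /=; apply: eq_bigr => e _.
rewrite big_fset_condE /= -card_fset_sum1.
(* If [e] composes with [z], its class is the [N]-th preimage of [prepend e z]; otherwise the class
   is empty. *)
case: eqP => ez.
  rewrite -[rng e]/(rng (prepend e z 0)) -IH; last exact: infinite_path_prepend.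
  rewrite /card_shift_preimage; congr (#|` _|); apply/fsetP => w.
  rewrite [RHS]in_fset_set; last exact: finite_shift_preimage.
  rewrite shift_preimage_prepend // in_setI.
  rewrite -[w \in shift_preimage _ _]in_fset_set; last exact: finite_shift_preimage.
  rewrite [LHS]in_fset [LHS]inE /=. congr (_ && _).
  by apply/idP/idP => [/eqP wN|]; rewrite inE //= => /eqP.
apply/eqP; rewrite cardfs_eq0; apply/eqP/fsetP => w; rewrite !inE /=.
rewrite in_fset_set; last exact: finite_shift_preimage.
apply/negP => /andP[]; rewrite inE => -[Ew /= wz] /eqP wN.
rewrite -wN -wz -[rng _]/(rng (iter N (@Defs.shift E) w 1%N)) iter_shift addn1 Ew in ez.
exact: ez.
Qed.

(** * Existence of infinite paths *)

(** Paths run against the arrows: choose an edge into each vertex of [T] from within [T], then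
    iterate through sources. *)
Lemma infinite_path_of_closed (T : {set vertex E}) x :
  (forall y, y \in T -> exists2 e, rng e = y & src e \in T) -> x \in T ->
  exists2 z, infinite_path z & rng (z 0%N) = x.
Proof.
move=> TP xT; have [e0 _ _] := TP x xT.
have /choice[h hP] : forall y, exists e, y \in T -> rng e = y /\ src e \in T.
  move=> y; have [yT|yT] := boolP (y \in T); last by exists e0.
  by have [e] := TP y yT; exists e.
pose y i := iter i (fun y => src (h y)) x.
have yT i : y i \in T by elim: i => //= i /hP[].
exists (fun i => h (y i)); last by have [] := hP x xT.
by move=> i; have [] := hP _ (yT i.+1).
Qed.

Lemma infinite_path_of_cycle : has_cycle E -> @infinite_path E !=set0.
Proof.
move=> [c [c0 cc]].
pose T := [set x | x \in map (@rng E) c]%SET.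
have TP y : y \in T -> exists2 e, rng e = y & src e \in T.
  rewrite inE => /mapP[e ec ->]; exists e => //.
  by rewrite inE (eqP (next_cycle cc ec)) map_f // mem_next.
case: c c0 cc @T TP => // e c _ _ T TP.
have [|z Ez _] := @infinite_path_of_closed T (rng e) TP; last by exists z.
by rewrite inE mem_head.
Qed.

(* The next vertices on the way toward ranges eventually recur; a minimal
   nonempty set stable under the chosen step is permuted by it, so its edges can
   be followed backwards forever. *)
Lemma infinite_path_of_forward_closed (S : {set vertex E}) x :
  x \in S -> (forall y, y \in S -> exists2 e, src e = y & rng e \in S) ->
  exists2 z, infinite_path z & rng (z 0%N) \in S.
Proof.
move=> xS SP; have [e0 _ _] := SP x xS.
have /choice[h hP] : forall y, exists e, y \in S -> src e = y /\ rng e \in S.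
  move=> y; have [yT|yT] := boolP (y \in S); last by exists e0.
  by have [e] := SP y yT; exists e.
pose g y := rng (h y).
pose P (T : {set vertex E}) := [&& T != finset.set0, T \subset S & g @: T \subset T].
have PS : P S.
  apply/and3P; split=> //; first by apply/set0Pn; exists x.
  by apply/fintype.subsetP => _ /imsetP[y yS ->]; have [] := hP y yS.
have [T /minsetP[/and3P[T0 TS gT] Tmin] _] := minset_exists PS.
have gTT : g @: T = T.
  apply: Tmin => //; apply/and3P; split; last exact: imsetS.
    have /set0Pn[t tT] := T0.
    by apply/set0Pn; exists (g t); exact: imset_f.
  exact: fintype.subset_trans gT TS.
have /set0Pn[t tT] := T0.
have [|z Ez zt] := @infinite_path_of_closed T t _ tT.
  move=> y; rewrite -{1}gTT => /imsetP[u uT ->]; exists (h u) => //.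
  by have [->] := hP u (fintype.subsetP TS _ uT).
by exists z => //; rewrite zt (fintype.subsetP TS).
Qed.

Lemma path_count_le_max (R : realType) N z : infinite_path z ->
  (path_count N (rng (z 0%N)))%:R <= max_shift_preimage E R N.
Proof.
move=> Ez; have [w _ [-> wmax]] := @max_shift_preimage_attained E R N (ex_intro _ z Ez).
by rewrite ler_nat -card_shift_preimageE // wmax.
Qed.

(** A path [z] is a preimage of its own [N]-th shift, so some count is positive. *)
Lemma max_shift_preimage_ge1 (R : realType) N :
  @infinite_path E !=set0 -> 1 <= max_shift_preimage E R N.
Proof.
move=> [z Ez]; pose w := iter N (@Defs.shift E) z.
have Ew : infinite_path w by move=> i; rewrite /w !iter_shift addnS.
apply: le_trans (path_count_le_max R N Ew).
rewrite -card_shift_preimageE // ler1n cardfs_gt0; apply/fset0Pn; exists z.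
by rewrite in_fset_set ?inE; [split | exact: finite_shift_preimage].
Qed.

(** * The vertex matrix and its eigenvectors *)

Lemma mulmx_vertex_matrix (K : nzRingType) (u : 'rV[K]_#|vertex E|) x :
  (u *m vertex_matrix E K) 0 (enum_rank x) =
  \sum_(e | src e == x) u 0 (enum_rank (rng e)).
Proof.
rewrite mxE (reindex _ (onW_bij _ (@enum_rank_bij (vertex E)))) /=.
rewrite [RHS](partition_big (@rng E) predT) //=; apply: eq_bigr => y _.
rewrite mxE !enum_rankK.
under eq_bigr => e /andP[_ /eqP->] do [].
rewrite sumr_const -[RHS]mulr_natr; congr (_ * _%:R); apply: eq_card => e.
by rewrite [RHS]unfold_in /= [RHS]andbC unfold_in /in_set asboolb.
Qed.

Lemma path_countE (K : nzRingType) N x :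
  (path_count N x)%:R =
  (const_mx 1 *m (vertex_matrix E K) ^+ N : 'rV[K]_#|vertex E|) 0 (enum_rank x).
Proof.
elim: N x => [|N IH] x; first by rewrite expr0 mulmx1 mxE.
rewrite exprSr mulmxA mulmx_vertex_matrix /= natr_sum.
by apply: eq_bigr => e _; rewrite IH.
Qed.

(** Unfolding the eigenvector equation [N] times gives a sum over paths with source [x] of entries
    of [v], each bounded by the sum of all moduli. *)
Lemma eigenvector_le_path_count (C : numFieldType)
    (v : 'rV[C]_#|vertex E|) (l : C) N x :
  v *m vertex_matrix E C = l *: v ->
  `|l| ^+ N * `|v 0 (enum_rank x)| <= (\sum_j `|v 0 j|) * (path_count N x)%:R.
Proof.
move=> vl; elim: N x => [|N IH] x.
  rewrite mul1r mulr1 (bigD1 (enum_rank x)) //= lerDl.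
  by apply: sumr_ge0 => j _.
have := mulmx_vertex_matrix v x; rewrite vl mxE => lv.
rewrite exprSr -mulrA -normrM lv /= natr_sum mulr_sumr.
apply: (@le_trans _ _ (`|l| ^+ N * \sum_(e | src e == x) `|v 0 (enum_rank (rng e))|)).
  by rewrite ler_wpM2l ?exprn_ge0 // ler_norm_sum.
by rewrite mulr_sumr; apply: ler_sum => e _; exact: IH.
Qed.

Lemma eigenvector_infinite_path (C : numFieldType)
    (v : 'rV[C]_#|vertex E|) (l : C) :
  v *m vertex_matrix E C = l *: v -> v != 0 -> l != 0 ->
  exists2 z, infinite_path z & v 0 (enum_rank (rng (z 0%N))) != 0.
Proof.
move=> vl v0 l0; pose S := [set x | v 0 (enum_rank x) != 0]%SET.
have [j vj] : exists j, v 0 j != 0.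
  apply/existsP; apply: contraNT v0 => /existsPn v0.
  by apply/eqP/rowP => j; rewrite mxE; apply/eqP/negPn.
have [||z Ez] := @infinite_path_of_forward_closed S (enum_val j).
- by rewrite inE enum_valK.
- move=> y; rewrite inE => vy.
  have : l * v 0 (enum_rank y) != 0 by rewrite mulf_neq0.
  have := mulmx_vertex_matrix v y; rewrite vl mxE => ->.
  apply: contraNP => noe; rewrite big1 // => e /eqP ey.
  by apply/eqP/negPn/negP => ve; apply: noe; exists e; rewrite ?inE.
- by rewrite inE; exists z.
Qed.

End PathCounts.

(** * Geometric bounds for matrix powers *)

Lemma le_geometric_of_step (C : numFieldType) (l r b : C) (a : nat -> C) :
  `|l| < r -> (forall N, `|a N.+1 - l * a N| <= b * r ^+ N) ->
  exists D, forall N, `|a N| <= D * r ^+ N.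
Proof.
move=> lr ab; have r0 : 0 <= r by apply: le_trans (ltW lr).
have rl0 : 0 < r - `|l| by rewrite subr_gt0.
have b0 : 0 <= b by have := ab 0%N; rewrite expr0 mulr1; apply: le_trans.
(* The second summand solves D r = b + |l| D, so the recursion preserves it; the first covers the
   initial value. *)
exists (`|a 0%N| + b / (r - `|l|)); elim=> [|N IH].
  by rewrite mulr1 lerDl divr_ge0 // ltW.
rewrite -(subrK (l * a N) (a N.+1)); apply: le_trans (ler_normD _ _) _.
apply: le_trans (lerD (ab N) (_ : _ <= `|l| * _)) _.
  by rewrite normrM; apply: ler_wpM2l IH.
rewrite exprSr -subr_ge0.
set D := `|a 0%N| + _; suff -> : D * (r ^+ N * r) - (b * r ^+ N + `|l| * (D * r ^+ N)) =
    `|a 0%N| * (r - `|l|) * r ^+ N.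
  by rewrite !mulr_ge0 ?exprn_ge0 // ltW.
by rewrite /D; field; rewrite gt_eqF.
Qed.

(** With a(N) = u A^N w, the difference a(N+1) - l a(N) is the same sequence for the row u (A - l),
    which the remaining factors annihilate. *)
Lemma le_geometric_of_annihilator (C : numFieldType) n (A : 'M[C]_n) (r : C)
    (s : seq C) (u : 'rV_n) (w : 'cV_n) :
  (forall l, l \in s -> `|l| < r) ->
  u *m \prod_(l <- s) (A - l%:M) = 0 ->
  exists D, forall N, `|(u *m A ^+ N *m w) 0 0| <= D * r ^+ N.
Proof.
elim: s u => [|l s IH] u sr.
  rewrite big_nil mulmx1 => ->; exists 0 => N.
  by rewrite !mul0mx mxE normr0 mul0r.
rewrite big_cons mulmxA => us.
have [|b bP] := IH (u *m (A - l%:M)) _ us.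
  by move=> k ks; apply: sr; rewrite in_cons ks orbT.
apply: (@le_geometric_of_step _ l r b); first by apply: sr; rewrite mem_head.
move=> N; have := bP N; rewrite mulmxBr mul_mx_scalar !mulmxBl -!scalemxAl.
by rewrite !mxE -mulmxA -[A *m A ^+ N]exprS.
Qed.

Lemma le_geometric_mx (C : numClosedFieldType) n (A : 'M[C]_n) (r : C)
    (u : 'rV_n) (w : 'cV_n) :
  (forall l, eigenvalue A l -> `|l| < r) ->
  exists D, forall N, `|(u *m A ^+ N *m w) 0 0| <= D * r ^+ N.
Proof.
case: n A u w => [|n] A u w Ar.
  exists 0 => N; rewrite (_ : u = 0); last by apply/rowP => -[].
  by rewrite !mul0mx mxE normr0 mul0r.
have [s] := closed_field_poly_normal (char_poly A).
rewrite (monicP (char_poly_monic A)) scale1r => sE.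
apply: (@le_geometric_of_annihilator _ _ _ _ s) => [l ls|].
  by apply: Ar; rewrite eigenvalue_root_char sE root_prod_XsubC.
suff -> : \prod_(l <- s) (A - l%:M) = 0 by rewrite mulmx0.
rewrite -(Cayley_Hamilton A) sE rmorph_prod; apply: eq_bigr => l _.
by rewrite rmorphB /= horner_mx_X horner_mx_C.
Qed.

(** * Growth rates as limits of logarithms *)

(** The constants [D] become additive under the logarithm and vanish after division by [N]. *)
Lemma cvg_ln_root (R : realType) (M : nat -> R) (rho : R) :
  (forall N, 1 <= M N) ->
  (forall r, rho < r -> 0 < r -> exists D, forall N, M N <= D * r ^+ N) ->
  (forall r, r < rho -> 0 < r -> exists D, forall N, r ^+ N <= D * M N) ->
  (fun N : nat => N%:R^-1 * ln (M N)) @ \oo --> ln rho.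
Proof.
move=> M1 Mub Mlb.
have M0 N : 0 < M N by exact: lt_le_trans (M1 N).
(* Otherwise some [r] below 1 would force [M N] to 0. So [ln rho] is a true logarithm, not a default
   value. *)
have rho1 : 1 <= rho.
  rewrite leNgt; apply/negP => rho1.
  have [r /andP[/andP[rhor r0] r1]] : exists r : R, (rho < r) && (0 < r) && (r < 1).
    (* The maximum keeps [r] positive even if [rho] is negative. *)
    exists ((Num.max rho 0 + 1) / 2).
    by have [h|h] := leP rho 0; apply/andP; split; try (apply/andP; split); lra.
  have [D DP] := Mub r rhor r0.
  have : (fun N => D * r ^+ N) @ \oo --> D * 0.
    by apply: cvgMr; apply: cvg_expr; rewrite gtr0_norm.
  rewrite mulr0 => /cvgrPdist_lt/(_ 1 ltr01)[N _ /(_ N (leqnn N))] /=.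
  rewrite sub0r normrN => DN; have := le_trans (M1 N) (DP N).
  by rewrite leNgt (le_lt_trans (ler_norm _) DN).
have rho0 : 0 < rho by exact: lt_le_trans rho1.
have lnr e : ln (rho * expR e) = ln rho + e.
  by rewrite lnM ?posrE ?expR_gt0 // expRK.
(* Half of [e] pays for moving [rho] by a factor exp(e/2) or exp(-e/2), the other half for the
   constants. *)
apply/cvgrPdist_le => e e0; have e20 : 0 < e / 2 by rewrite divr_gt0.
have [D DP] : exists D, forall N, M N <= D * (rho * expR (e / 2)) ^+ N.
  by apply: Mub; rewrite ?mulr_gt0 ?expR_gt0 // ltr_pMr // expR_gt1.
have [G GP] : exists D, forall N, (rho * expR (- (e / 2))) ^+ N <= D * M N.
  by apply: Mlb; rewrite ?mulr_gt0 ?expR_gt0 // gtr_pMr // expR_lt1 oppr_lt0.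
have D0 : 0 < D by have := DP 0%N; rewrite expr0 mulr1; apply: lt_le_trans.
have G0 : 0 < G.
  by have := lt_le_trans ltr01 (GP 0%N); rewrite pmulr_lgt0.
have ubN N : ln (M N) <= ln D + (ln rho + e / 2) *+ N.
  have rN : 0 < (rho * expR (e / 2)) ^+ N by rewrite exprn_gt0 // mulr_gt0 ?expR_gt0.
  have := DP N; rewrite -ler_ln ?posrE ?mulr_gt0 //.
  by rewrite lnM ?posrE // lnXn ?mulr_gt0 ?expR_gt0 // lnr.
have lbN N : (ln rho - e / 2) *+ N <= ln G + ln (M N).
  have rN : 0 < (rho * expR (- (e / 2))) ^+ N by rewrite exprn_gt0 // mulr_gt0 ?expR_gt0.
  have := GP N; rewrite -ler_ln ?posrE ?mulr_gt0 //.
  by rewrite [ln (G * _)]lnM ?posrE // lnXn ?mulr_gt0 ?expR_gt0 // lnr.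
pose K := (`|ln D| + `|ln G|) / (e / 2).
have [n Kn] : exists n : nat, K <= n%:R.
  by exists (Num.bound K); apply/ltW/archi_boundP; rewrite divr_ge0 ?addr_ge0 // ltW.
exists n.+1 => // N /= nN.
have N0 : 0 < N%:R :> R by rewrite ltr0n (leq_trans _ nN).
have KN : `|ln D| + `|ln G| <= e / 2 * N%:R.
  rewrite mulrC -ler_pdivrMr //; apply: le_trans Kn _.
  by rewrite ler_nat ltnW.
have dD := ler_norm (ln D); have dG := ler_norm (ln G).
have pD := normr_ge0 (ln D); have pG := normr_ge0 (ln G).
have lN := lbN N; have uN := ubN N.
rewrite ler_distlC [_ * ln _]mulrC.
rewrite ler_pdivrMr // ler_pdivlMr //.
rewrite -mulr_natr in lN. rewrite -mulr_natr in uN.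
have eE : e = e / 2 + e / 2 by rewrite -splitr.
rewrite {1 2}eE opprD !addrA ![(_ + _ + _) * _]mulrDl mulNr.
apply/andP; split.
  by rewrite lerBlDr; move: lN KN dG pD; clear; lra.
by move: uN KN dD pG; clear; lra.
Qed.

(** * Complex spectrum and growth of the counts *)

Lemma normc_Re (R : rcfType) (x : R[i]) : `|x| = ((complex.Re `|x|)%:C)%C.
Proof. by rewrite normc_def. Qed.

(** The characteristic polynomial has positive degree, hence a root, and the sum of the moduli of
    its roots bounds each of them. *)
Lemma has_sup_spectrum (R : realType) n (A : 'M[R[i]]_n) : (0 < n)%N ->
  has_sup [set complex.Re `|l| | l in [set l : R[i] | eigenvalue A l]].
Proof.
case: n A => // n A _.
have [s] := closed_field_poly_normal (char_poly A).
rewrite (monicP (char_poly_monic A)) scale1r => sE.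
have eigs l : eigenvalue A l = (l \in s).
  by rewrite eigenvalue_root_char sE root_prod_XsubC.
split.
  case: s sE eigs => [|l s] sE eigs.
    by have := size_char_poly A; rewrite sE big_nil size_poly1.
  by exists (complex.Re `|l|), l => //=; rewrite eigs mem_head.
exists (\sum_(l <- s) complex.Re `|l|) => x [l /=]; rewrite eigs => ls <-.
rewrite (big_rem l) //= lerDl; apply: sumr_ge0 => k _.
by rewrite -lecR -normc_Re normr_ge0.
Qed.

Theorem proposition7p3 (R : realType) (E : digraph) (hE : has_cycle E) :
  (fun N : nat => N%:R^-1 * ln (max_shift_preimage E R N)) @ \oo -->
    ln (spectral_radius (vertex_matrix E R[i])).
Proof.
have ex_path := infinite_path_of_cycle hE.
have sup_spec : has_sup [set complex.Re `|l|
    | l in [set l : R[i] | eigenvalue (vertex_matrix E R[i]) l]].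
  have [z _] := ex_path; apply: has_sup_spectrum.
  by apply/card_gt0P; exists (rng (z 0%N)).
apply: cvg_ln_root; [move=> N|move=> r rhor r0|move=> r rrho r0].
- exact: max_shift_preimage_ge1.
(* All-ones vectors on both sides give the sum of all path counts, which dominates each of them. *)
- have [l Al|D DP] := @le_geometric_mx R[i] _ (vertex_matrix E R[i]) (r%:C)%C
      (const_mx 1) (const_mx 1).
    rewrite normc_Re ltcR; apply: le_lt_trans rhor.
    by apply: ub_le_sup; [exact: sup_spec.2 | exists l].
  (* Order in [R[i]] means equal imaginary parts and ordered real parts, so the real part of [D]
     suffices. *)
  exists (complex.Re D) => N.
  have [z Ez [-> _]] := @max_shift_preimage_attained E R N ex_path.
  rewrite card_shift_preimageE //.
  have : ((path_count N (rng (z 0%N)))%:R : R[i]) <= D * (r%:C)%C ^+ N.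
    apply: le_trans (DP N); rewrite mxE.
    rewrite (eq_bigr (fun j => (path_count N (enum_val j))%:R)); last first.
      by move=> j _; rewrite [X in _ * X]mxE mulr1 path_countE enum_valK.
    rewrite -natr_sum normr_nat ler_nat.
    rewrite (bigD1 (enum_rank (rng (z 0%N)))) //= enum_rankK.
    exact: leq_addr.
  rewrite -rmorphXn /= lecE => /andP[_].
  rewrite -(rmorph_nat (real_complex R)) /=.
  by case: D {DP} => a b /=; rewrite mulr0 subr0.
(* As [r] is below the supremum, some eigenvalue has modulus above [r]. *)
- have [_ [l /eigenvalueP[v vl v0] <-]] := sup_adherent
    (ltac:(by rewrite subr_gt0) : 0 < spectral_radius (vertex_matrix E R[i]) - r) sup_spec.
  rewrite subKr => rl.
  have l0 : l != 0.
    by apply: contraTneq rl => ->; rewrite normr0 /= -leNgt ltW.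
  have [z Ez vz] := eigenvector_infinite_path vl v0 l0.
  set c := complex.Re `|v 0 (enum_rank (rng (z 0%N)))|.
  set K := complex.Re (\sum_j `|v 0 j|).
  have c0 : 0 < c by rewrite -ltcR -normc_Re normr_gt0.
  have KE : \sum_j `|v 0 j| = (K%:C)%C.
    rewrite /K raddf_sum rmorph_sum /=.
    by apply: eq_bigr => j _; exact: normc_Re.
  have K0 : 0 <= K by rewrite -lecR -KE; apply: sumr_ge0.
  (* The constant comes from dividing |l|^N c <= K [path_count] by [c]. *)
  exists (K / c) => N; rewrite mulrAC ler_pdivlMr //.
  have lN : complex.Re `|l| ^+ N * c <= K * (path_count N (rng (z 0%N)))%:R.
    have := eigenvector_le_path_count N (rng (z 0%N)) vl.
    rewrite KE (normc_Re l) (normc_Re (v _ _)) -(rmorph_nat (real_complex R)).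
    by rewrite -rmorphXn -!rmorphM /= lecR.
  apply: le_trans (le_trans lN _); last first.
    by rewrite ler_wpM2l // path_count_le_max.
  by rewrite ler_pM2r // lerXn2r ?nnegrE ?ltW // (lt_trans r0).
Qed.
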